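(* Let $q\in\Bbbk^\times$ with $q\neq 1$, and let $A=\Bbbk\langle a,c\mid ac-qca\rangle$ be the quantum plane, viewed as a skew polynomial ring $A=\Bbbk[c][a;\sigma_1]$ with $\sigma_1(c)=qc$. There are two possibilities for an involutive skew polynomial extension (ISPE) $P=A[d;\sigma_2,\delta_2]$ of $\Bbbk[c]$: if $P$ is such an ISPE, then it has the relations $ac=qca$ and $dc=qcd$, together with either $da=ad$, or $da+ad=h$ for some $h\in\Bbbk[c]$.
   Context: $\Bbbk$ is an algebraically closed field of characteristic zero. For an automorphism $\sigma$ of a ring $R$, a $\sigma$-derivation is a $\Bbbk$-linear map $\delta:R\to R$ with $\delta(rs)=\sigma(r)\delta(s)+\delta(r)s$; the skew polynomial ring $R[x;\sigma,\delta]$ has commutation rule $xr=\sigma(r)x+\delta(r)$ for $r\in R$ (written $R[x;\sigma]$ if $\delta=0$). An involutive skew polynomial extension (ISPE) of $R$ is an iterated skew polynomial ring $S=R[a;\sigma_1,\delta_1][d;\sigma_2,\delta_2]$ (with $\sigma_2$ an automorphism of, and $\delta_2$ a $\sigma_2$-derivation on, $R[a;\sigma_1,\delta_1]$) for which there is an automorphism $\tau$ of $S$ with $\tau(a)=d$, $\tau(d)=a$ and $\tau(r)=r$ for all $r\in R$. *)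

(* Defs.v *)
From HB Require Import structures.
From mathcomp Require Import all_boot all_order all_algebra.
Set Implicit Arguments.
Unset Strict Implicit.
Unset Printing Implicit Defensive.
Import GRing.Theory.
Local Open Scope ring_scope.

Definition skew_derivation (k : fieldType) (R : algType k)
    (sigma : {lrmorphism R -> R}) (delta : {linear R -> R}) : Prop :=
  forall r s : R, delta (r * s) = sigma r * delta s + delta r * s.

(* S = R[x; sigma, delta], with R embedded in S through iota: x r = sigma(r) x
   + delta(r), and S is a free left R-module on 1, x, x^2, ... In spx_basis the
   type {poly R} only serves as the type of finitely supported coefficient
   sequences; its multiplication is not used.  Injectivity of iota follows from
   spx_basis. *)
Record is_skew_poly_ext (k : fieldType) (R S : algType k)
    (iota : {lrmorphism R -> S}) (x : S)
    (sigma : {lrmorphism R -> R}) (delta : {linear R -> R}) : Prop := {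
  spx_auto : bijective sigma;
  spx_der : skew_derivation sigma delta;
  spx_comm : forall r : R, x * iota r = iota (sigma r) * x + iota (delta r);
  spx_basis :
    bijective (fun p : {poly R} => \sum_(i < size p) iota p`_i * x ^+ i)
}.

(* The chain R -> A -> S exhibits S = R[a; sigma1, delta1][d; sigma2, delta2] as
   an involutive skew polynomial extension of R, with A = R[a; sigma1, delta1]. *)
Record is_ISPE (k : fieldType) (R A S : algType k)
    (iota1 : {lrmorphism R -> A}) (a : A)
    (sigma1 : {lrmorphism R -> R}) (delta1 : {linear R -> R})
    (iota2 : {lrmorphism A -> S}) (d : S)
    (sigma2 : {lrmorphism A -> A}) (delta2 : {linear A -> A}) : Prop := {
  ispe_inner : is_skew_poly_ext iota1 a sigma1 delta1;
  ispe_outer : is_skew_poly_ext iota2 d sigma2 delta2;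
  ispe_invol : exists tau : {lrmorphism S -> S},
    [/\ bijective tau, tau (iota2 a) = d, tau d = iota2 a
      & forall r : R, tau (iota2 (iota1 r)) = iota2 (iota1 r)]
}.

(* Main.v *)
Require Import Defs.
From HB Require Import structures.
From mathcomp Require Import all_boot all_order all_algebra.
Set Implicit Arguments.
Unset Strict Implicit.
Unset Printing Implicit Defensive.
Import GRing.Theory.
Local Open Scope ring_scope.

(** Why the proposition holds.  Write c for the variable of k[c].  The involution
    tau fixes c and exchanges a and d, so applying it to ac = qca gives dc = qcd;
    comparing with the commutation rule of d, sigma2 c = qc.  Hence sigma2 agrees
    with sigma1 on k[c] ([lrmorphism_polyX_eq]), and in particular permutes k[c].

    Expand sigma2 a = sum_i F_i(c) a^i and delta2 a = sum_i G_i(c) a^i.  The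
    relation da = (sigma2 a) d + delta2 a becomes, under tau,
      ad = sum_i F_i(c) d^i a + sum_i G_i(c) d^i.
    Since d^i a has leading term sigma2^i(a) d^i ([coef_lmulx_iter_top]), the
    coefficient of the highest power d^n on the right is
    F_n sigma2^n(a) + G_n ([involution_coef_top]).  If n >= 2 this must vanish,
    and pulling back along sigma2^n, which permutes k[c], yields a dependency of
    a and 1 over k[c]; so F and G have degree at most 1
    ([involution_degree_le1]).  Applying sigma2 to ac = qca kills F_0 because
    q <> 1.  The coefficients of d and 1 in the displayed relation now read
      F_1^2 a + G_1 = a   and   F_1 G_1 a + (F_1 + 1) G_0 = 0,
    whence G_1 = 0 and F_1 = 1 or -1.  If F_1 = 1 then 2 G_0 = 0, so G_0 = 0 and
    da = ad; if F_1 = -1 then da + ad = G_0(c). *)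

Lemma lrmorphism_polyX_eq (k : fieldType) (B : algType k)
    (f g : {lrmorphism {poly k} -> B}) : f 'X = g 'X -> f =1 g.
Proof.
move=> fgX p; rewrite -(coefK p) poly_def !linear_sum.
by apply: eq_bigr => i _; rewrite !linearZ !rmorphXn /= fgX.
Qed.

(** * Coefficient sequences in a skew polynomial extension *)

Section SkewExpansion.

Variables (k : fieldType) (R S : algType k).
Variables (iota : {lrmorphism R -> S}) (x : S).

Definition skew_sum (p : {poly R}) : S := \sum_(i < size p) iota p`_i * x ^+ i.

Lemma skew_sum_wide n (p : {poly R}) : (size p <= n)%N ->
  skew_sum p = \sum_(i < n) iota p`_i * x ^+ i.
Proof.
move=> le_p_n; rewrite /skew_sum (big_ord_widen _ (fun i => iota p`_i * x ^+ i) le_p_n).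
rewrite big_mkcond; apply: eq_bigr => i _; case: ltnP => // le_p_i.
by rewrite nth_default // rmorph0 mul0r.
Qed.

Lemma skew_sumD p r : skew_sum (p + r) = skew_sum p + skew_sum r.
Proof.
pose n := maxn (size p) (size r).
rewrite !(@skew_sum_wide n) ?leq_maxl ?leq_maxr ?size_polyD // -big_split /=.
by apply: eq_bigr => i _; rewrite coefD rmorphD mulrDl.
Qed.

Lemma skew_sum0 : skew_sum 0 = 0.
Proof. by rewrite /skew_sum size_poly0 big_ord0. Qed.

Lemma skew_sum_big n (F : nat -> {poly R}) :
  skew_sum (\sum_(i < n) F i) = \sum_(i < n) skew_sum (F i).
Proof. exact: (big_morph skew_sum skew_sumD skew_sum0). Qed.

Lemma skew_sumCM r p : skew_sum (r%:P * p) = iota r * skew_sum p.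
Proof.
rewrite (@skew_sum_wide (size p)).
  rewrite /skew_sum mulr_sumr; apply: eq_bigr => i _.
  by rewrite coefCM rmorphM mulrA.
by rewrite mul_polyC size_scale_leq.
Qed.

Lemma skew_sumMX p : skew_sum (p * 'X) = skew_sum p * x.
Proof.
rewrite (@skew_sum_wide (size p).+1); last first.
  by apply: leq_trans (size_polyMleq _ _) _; rewrite size_polyX addn2.
rewrite big_ord_recl coefMX rmorph0 mul0r add0r /skew_sum mulr_suml.
by apply: eq_bigr => i _; rewrite coefMX /= exprSr mulrA.
Qed.

Lemma skew_sumC r : skew_sum r%:P = iota r.
Proof.
by rewrite (@skew_sum_wide 1) ?size_polyC_leq1 // big_ord1 coefC mulr1.
Qed.

Lemma skew_sumXn n : skew_sum 'X^n = x ^+ n.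
Proof.
elim: n => [|n IHn]; first by rewrite !expr0 -polyC1 skew_sumC rmorph1.
by rewrite !exprSr skew_sumMX IHn.
Qed.

Variables (sigma : {lrmorphism R -> R}) (delta : {linear R -> R}).

(** Left multiplication by x, read off on coefficient sequences. *)
Definition lmulx (p : {poly R}) : {poly R} :=
  map_poly sigma p * 'X + map_poly delta p.

Lemma coef_lmulx_iter_gt n r m : (n < m)%N -> (iter n lmulx r%:P)`_m = 0.
Proof.
elim: n m => [|n IHn] [|m] //= lt_nm; first by rewrite coefC.
rewrite coefD coefMX /= !coef_map_id0 ?raddf0 // !IHn ?raddf0 ?addr0 //.
exact: ltnW.
Qed.

(** Moving x^n past r leaves the leading term sigma^n(r) x^n, the corrections by
    delta all having lower degree in x. *)
Lemma coef_lmulx_iter_top n r : (iter n lmulx r%:P)`_n = iter n sigma r.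
Proof.
elim: n => [|n IHn] /=; first by rewrite coefC.
rewrite coefD coefMX /= !coef_map_id0 ?raddf0 // IHn.
by rewrite coef_lmulx_iter_gt // raddf0 addr0.
Qed.

Hypothesis ext : is_skew_poly_ext iota x sigma delta.

Lemma skew_sum_inj : injective skew_sum.
Proof. exact: bij_inj (spx_basis ext). Qed.

Lemma skew_sum_surj s : exists p, s = skew_sum p.
Proof. by have [g _ gK] := spx_basis ext; exists (g s); rewrite [RHS]gK. Qed.

Lemma skew_linear_inj r0 r1 s0 s1 :
  iota r0 + iota r1 * x = iota s0 + iota s1 * x -> r0 = s0 /\ r1 = s1.
Proof.
have lin (t0 t1 : R) : iota t0 + iota t1 * x = skew_sum (t0%:P + t1%:P * 'X).
  by rewrite skew_sumD skew_sumMX !skew_sumC.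
rewrite !lin => /skew_sum_inj eq_rs.
by split; [have := congr1 (coefp 0) eq_rs | have := congr1 (coefp 1) eq_rs];
   rewrite /coefp !coefD !coefMX !coefC /= ?addr0 ?add0r.
Qed.

Lemma skew_sum_lmulx p : skew_sum (lmulx p) = x * skew_sum p.
Proof.
rewrite skew_sumD skew_sumMX !(@skew_sum_wide (size p)) ?size_poly //.
rewrite mulr_suml mulr_sumr -big_split /=; apply: eq_bigr => i _.
rewrite !coef_map_id0 ?raddf0 // [RHS]mulrA (spx_comm ext) mulrDl.
by rewrite -!mulrA -exprSr -exprS.
Qed.

Lemma skew_sum_lmulx_iter n r : skew_sum (iter n lmulx r%:P) = x ^+ n * iota r.
Proof.
elim: n => [|n IHn]; first by rewrite skew_sumC mul1r.
by rewrite iterS skew_sum_lmulx IHn exprS mulrA.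
Qed.

End SkewExpansion.

(** * The relation da = (sigma2 a) d + delta2 a under the involution *)

Section Involution.

Variables (k : fieldType) (R A S : algType k).
Variables (iota1 : {lrmorphism R -> A}) (a : A).
Variables (sigma1 : {lrmorphism R -> R}) (delta1 : {linear R -> R}).
Variables (iota2 : {lrmorphism A -> S}) (d : S).
Variables (sigma2 : {lrmorphism A -> A}) (delta2 : {linear A -> A}).
Hypothesis ispe : is_ISPE iota1 a sigma1 delta1 iota2 d sigma2 delta2.

Variables F G : {poly R}.
Hypothesis sigma2_a : sigma2 a = skew_sum iota1 a F.
Hypothesis delta2_a : delta2 a = skew_sum iota1 a G.

(** The involution turns the expansion of da into an expansion of ad in powers
    of d with coefficients in A, which must be the trivial one. *)
Lemma involution_expansion n : (size F <= n)%N -> (size G <= n)%N ->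
  \sum_(i < n) ((iota1 F`_i)%:P * iter i (lmulx sigma2 delta2) a%:P
                + (iota1 G`_i)%:P * 'X^i) = a%:P * 'X.
Proof.
move=> leFn leGn; have [ext1 ext2 [tau [_ tau_a tau_d tau_R]]] := ispe.
apply: (skew_sum_inj ext2).
rewrite (skew_sum_big iota2 d n (fun i => (iota1 F`_i)%:P
  * iter i (lmulx sigma2 delta2) a%:P + (iota1 G`_i)%:P * 'X^i)).
rewrite skew_sumMX skew_sumC.
have -> : iota2 a * d = tau (d * iota2 a) by rewrite rmorphM /= tau_a tau_d.
rewrite (spx_comm ext2) rmorphD rmorphM /= tau_d sigma2_a delta2_a.
rewrite !(@skew_sum_wide _ _ _ iota1 a n) // !rmorph_sum mulr_suml.
rewrite -big_split /=; apply: eq_bigr => i _.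
rewrite skew_sumD !skew_sumCM skew_sumXn (skew_sum_lmulx_iter ext2).
by rewrite !rmorphM !rmorphXn /= tau_a !tau_R mulrA.
Qed.

(** Only the summand i = n reaches d^n. *)
Lemma involution_coef_top n : (size F <= n.+1)%N -> (size G <= n.+1)%N ->
  iota1 F`_n * iter n sigma2 a + iota1 G`_n = (a%:P * 'X)`_n.
Proof.
move=> leFn leGn; rewrite -(involution_expansion leFn leGn) coef_sum.
rewrite big_ord_recr /= coefD !coefCM coef_lmulx_iter_top coefXn eqxx mulr1.
rewrite big1 ?add0r // => i _.
by rewrite coefD !coefCM coef_lmulx_iter_gt // coefXn gtn_eqF // !mulr0 addr0.
Qed.

Hypothesis sigma2_R : forall r, sigma2 (iota1 r) = iota1 (sigma1 r).

(** The top coefficients F_n and G_n are sigma2^n-images of some f and g in R, so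
    F_n sigma2^n(a) + G_n = 0 gives f a + g = 0 and hence f = g = 0. *)
Lemma involution_degree_step n : (1 < n)%N ->
  (size F <= n.+1)%N -> (size G <= n.+1)%N -> (size F <= n)%N && (size G <= n)%N.
Proof.
move=> n_gt1 leFn leGn; have [ext1 ext2 _] := ispe.
have top0 : iota1 F`_n * iter n sigma2 a + iota1 G`_n = 0.
  rewrite involution_coef_top // coefMX coefC.
  by case: (n) n_gt1 => [|[|m]].
have sigma2n_R r m : iter m sigma2 (iota1 r) = iota1 (iter m sigma1 r).
  by elim: m => //= m ->; rewrite sigma2_R.
have [g sigma1K gK] := spx_auto ext1.
have iterK r m : iter m sigma1 (iter m g r) = r.
  by elim: m r => //= m IHm r; rewrite -iterS iterSr gK.
have sigma2n_inj m : injective (iter m sigma2).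
  elim: m => // m IHm u v /= /(bij_inj (spx_auto ext2)); exact: IHm.
have sigma1n0 m : iter m sigma1 0 = 0 by elim: m => //= m ->; rewrite rmorph0.
pose f0 := iter n g F`_n; pose g0 := iter n g G`_n.
have lin0 : iota1 g0 + iota1 f0 * a = iota1 0 + iota1 0 * a.
  apply: (sigma2n_inj n).
  have iterD m u v : iter m sigma2 (u + v) = iter m sigma2 u + iter m sigma2 v.
    by elim: m => //= m ->; rewrite rmorphD.
  have iterM m u v : iter m sigma2 (u * v) = iter m sigma2 u * iter m sigma2 v.
    by elim: m => //= m ->; rewrite rmorphM.
  rewrite !(iterD, iterM, sigma2n_R, iterK) addrC top0 sigma1n0.
  by rewrite rmorph0 mul0r addr0.
have [g0_0 f0_0] := skew_linear_inj ext1 lin0.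
have Fn0 : F`_n = 0 by rewrite -(iterK F`_n n) -/f0 f0_0 sigma1n0.
have Gn0 : G`_n = 0 by rewrite -(iterK G`_n n) -/g0 g0_0 sigma1n0.
apply/andP; split; apply/leq_sizeP => j; rewrite leq_eqVlt => /predU1P[<- //|ltnj].
  exact: (leq_sizeP _ _ leFn).
exact: (leq_sizeP _ _ leGn).
Qed.

Lemma involution_degree_le1 : (size F <= 2)%N && (size G <= 2)%N.
Proof.
have: (size F <= (size F + size G).+2)%N && (size G <= (size F + size G).+2)%N.
  by rewrite !(leqW (leqW _)) ?leq_addr ?leq_addl.
elim: (size F + size G)%N => // n IHn /andP[leF leG].
exact/IHn/involution_degree_step.
Qed.

End Involution.

(** * The extensions of the quantum plane *)

Theorem proposition5p3 (k : closedFieldType) (char0 : [pchar k] =i pred0)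
    (q : k) (q_neq0 : q != 0) (q_neq1 : q != 1)
    (A : algType k) (iota1 : {lrmorphism {poly k} -> A}) (a : A)
    (sigma1 : {lrmorphism {poly k} -> {poly k}})
    (sigma1_c : sigma1 'X = q *: 'X)
    (A_qplane : is_skew_poly_ext iota1 a sigma1 \0)
    (P : algType k) (iota2 : {lrmorphism A -> P}) (d : P)
    (sigma2 : {lrmorphism A -> A}) (delta2 : {linear A -> A})
    (P_ispe : is_ISPE iota1 a sigma1 \0 iota2 d sigma2 delta2) :
  let aP := iota2 a in
  let cP := iota2 (iota1 'X) in
  [/\ aP * cP = q *: (cP * aP),
      d * cP = q *: (cP * d)
    & d * aP = aP * d \/
      exists h : {poly k}, d * aP + aP * d = iota2 (iota1 h)].
Proof.
move=> aP cP; have [ext1 ext2 [tau [_ tau_a tau_d tau_R]]] := P_ispe.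
have ac : aP * cP = q *: (cP * aP).
  rewrite -!rmorphM (spx_comm ext1) raddf0 addr0 sigma1_c.
  by rewrite linearZ -scalerAl /= linearZ.
have dc : d * cP = q *: (cP * d).
  by have /= := congr1 tau ac; rewrite linearZ !rmorphM /= tau_a tau_R.
split=> //.
have sigma2_c : sigma2 (iota1 'X) = q *: iota1 'X.
  have lin : iota2 (delta2 (iota1 'X)) + iota2 (sigma2 (iota1 'X)) * d
           = iota2 0 + iota2 (q *: iota1 'X) * d.
    by rewrite addrC -(spx_comm ext2) rmorph0 add0r linearZ -scalerAl.
  by have [] := skew_linear_inj ext2 lin.
have sigma2_R : forall r, sigma2 (iota1 r) = iota1 (sigma1 r).
  apply: (lrmorphism_polyX_eq (f := sigma2 \o iota1) (g := iota1 \o sigma1)).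
  by rewrite /= sigma2_c sigma1_c linearZ.
have [F sigma2_a] := skew_sum_surj ext1 (sigma2 a).
have [G delta2_a] := skew_sum_surj ext1 (delta2 a).
have /andP[leF leG] := involution_degree_le1 P_ispe sigma2_a delta2_a sigma2_R.
have W := involution_expansion P_ispe sigma2_a delta2_a leF leG.
have top := involution_coef_top P_ispe sigma2_a delta2_a leF leG.
move: sigma2_a delta2_a.
rewrite !(@skew_sum_wide _ _ _ iota1 a 2) // !big_ord_recl !big_ord0 /= !addr0.
rewrite !expr0 !expr1 !mulr1 => sigma2_a delta2_a.
have c_neq0 : ('X : {poly k}) != 0 by rewrite polyX_eq0.
(* Applying sigma2 to ac = qca compares F_0 c with q c F_0. *)
have F0 : F`_0 = 0.
  have ac_A : a * iota1 'X = q *: (iota1 'X * a).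
    by rewrite (spx_comm ext1) raddf0 addr0 sigma1_c linearZ -scalerAl.
  have sac : sigma2 a * iota1 'X = q *: (iota1 'X * sigma2 a).
    apply: (scalerI q_neq0); rewrite scalerAr -sigma2_c -rmorphM ac_A.
    by rewrite [LHS]linearZ /= rmorphM /= sigma2_c -scalerAl.
  have : iota1 (F`_0 * 'X) + iota1 (F`_1 * (q *: 'X)) * a
       = iota1 (q *: ('X * F`_0)) + iota1 (q *: ('X * F`_1)) * a.
    move: sac; rewrite sigma2_a mulrDl mulrDr scalerDr -mulrA ac_A.
    have iota1Z r : iota1 (q *: r) = q *: iota1 r by rewrite linearZ.
    by rewrite -!scalerAr !iota1Z !rmorphM -!scalerAl !mulrA.
  case/(skew_linear_inj ext1)=> /eqP + _.
  rewrite mulrC -subr_eq0 -[X in X - _]scale1r -scalerBl scaler_eq0.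
  rewrite subr_eq0 eq_sym (negPf q_neq1) mulf_eq0 (negPf c_neq0) /=.
  by move/eqP.
rewrite F0 rmorph0 add0r in sigma2_a.
(* The coefficients of d and of 1 in the expansion of ad. *)
have coef1 : iota1 G`_1 + iota1 (F`_1 * F`_1) * a = iota1 0 + iota1 1 * a.
  rewrite rmorph0 rmorph1 mul1r add0r rmorphM -mulrA -sigma2_a addrC.
  by rewrite top coefMX coefC.
have coef0 : iota1 ((F`_1 + 1) * G`_0) + iota1 (F`_1 * G`_1) * a
           = iota1 0 + iota1 0 * a.
  have := congr1 (coefp 0) W.
  rewrite /coefp !big_ord_recl big_ord0 addr0 /= F0 rmorph0 polyC0 mul0r add0r.
  rewrite !(coefD, coefCM, coefX, coefMX, coefXn) /= mulr1 !mulr0 addr0 add0r.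
  rewrite coef_map_id0 ?raddf0 // coefC /= delta2_a mulrDr => ad0.
  rewrite mul0r addr0 -[RHS]ad0 mulrDl mul1r rmorphD !rmorphM /=.
  by rewrite [_ * _ + iota1 _]addrC -addrA -mulrA.
have [G1 sqrF1] := skew_linear_inj ext1 coef1.
have [F1G0 _] := skew_linear_inj ext1 coef0.
have da : d * aP = iota2 (iota1 F`_1) * aP * d + iota2 (iota1 G`_0).
  rewrite (spx_comm ext2) sigma2_a delta2_a G1 rmorph0 mul0r addr0.
  by rewrite rmorphM.
have /orP[/eqP F1 | /eqP F1] : (F`_1 == 1) || (F`_1 == -1).
  by rewrite -sqrf_eq1 expr2 sqrF1.
- left; move/eqP: F1G0; rewrite F1 -mulr2n mulf_eq0.
  have /negPf-> : (2%:R : {poly k}) != 0.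
    by rewrite -polyC_natr polyC_eq0 ((pcharf0P _).1 char0).
  by move=> /= /eqP G0; rewrite da F1 G0 !rmorph1 !rmorph0 mul1r addr0.
- right; exists G`_0; rewrite da F1 !rmorphN !rmorph1 mulN1r mulNr.
  by rewrite addrAC addNr add0r.
Qed.
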